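(* Let $k=2\log n$, and run the following greedy algorithm on a random graph $G(n,1/2)$ with vertex set $V$: partition $V$ into disjoint sets $V_1,\dots,V_k$, each of size $n/k$; set $S_0=\emptyset$; for $i=0,1,\dots,k-1$, let $v_{i+1}\in V_{i+1}$ be a vertex maximizing $|E(v,S_i)|$ over $v\in V_{i+1}$, and set $S_{i+1}=S_i\cup\{v_{i+1}\}$; output $S=S_k=\{v_1,\dots,v_k\}$. Then the output $S$ is a set of $k=2\log n$ vertices with $\mathrm{den}(S)\gtrsim 0.951$ almost surely, i.e., with probability tending to $1$ as $n\to\infty$, $\mathrm{den}(S)$ is at least $0.951$ up to lower-order ($o(1)$) terms.
   Context: $G(n,1/2)$ is the random graph on $n$ vertices in which each pair of vertices is an edge independently with probability $1/2$. For vertex subsets $S,T$, $E(S,T)$ is the set of edges with one endpoint in $S$ and the other in $T$; $E(v,S)=E(\{v\},S)$. The density of a vertex subset $S$ is $\mathrm{den}(S)=|E(S,S)|/\binom{|S|}{2}$. $\log$ is base $2$. Sizes such as $2\log n$ and $n/k$ are assumed to be integers. *)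

(* Defs.v *)
From mathcomp Require Export all_boot all_order all_algebra.
From mathcomp Require Export boolp classical_sets reals topology normedtype.
From mathcomp Require Export sequences exp.

Set Implicit Arguments.
Unset Strict Implicit.
Unset Printing Implicit Defensive.

Export Order.TTheory GRing.Theory Num.Theory.
Export numFieldNormedType.Exports.

Local Open Scope ring_scope.

(* A simple graph on the vertex set 'I_n is given by its edge set, a set of
   two-element sets of vertices. *)
Definition vpairs (n : nat) : {set {set 'I_n}} :=
  [set e : {set 'I_n} | #|e| == 2%N]%SET.

Definition graphs (n : nat) : {set {set {set 'I_n}}} := powerset (vpairs n).

(* G(n,p): the pairs are edges independently, each with probability p, so a
   graph G has mass \prod_e (p if e is an edge of G, 1 - p otherwise). *)
Definition gnp_mass (R : realType) (n : nat) (p : R) (G : {set {set 'I_n}}) : R :=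
  \prod_(e in vpairs n) (if e \in G then p else 1 - p).

Definition gnp_Pr (R : realType) (n : nat) (p : R)
    (A : pred {set {set 'I_n}}) : R :=
  \sum_(G in graphs n | A G) gnp_mass p G.

Definition edges_between (n : nat) (G : {set {set 'I_n}}) (S T : {set 'I_n}) :
    {set {set 'I_n}} :=
  [set e in G | [exists u in S, exists v in T, e == [set u; v]]]%SET.

Definition den (R : realType) (n : nat) (G : {set {set 'I_n}})
    (S : {set 'I_n}) : R :=
  #|edges_between G S S|%:R / 'C(#|S|, 2)%:R.

Definition log2 (R : realType) (x : R) : R := ln x / ln 2.

(* m is the floor or the ceiling of x; when x is an integer this says m = x. *)
Definition rounding (R : realType) (x : R) (m : nat) : Prop :=
  `|m%:R - x| < 1.

(* The sets V i are disjoint, cover all the vertices, and have size n / k, rounded. *)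
Definition equipartition (R : realType) (n k : nat) (V : 'I_k -> {set 'I_n}) :
    Prop :=
  [/\ forall i j, i != j -> [disjoint V i & V j],
      \bigcup_(i < k) V i = [set: 'I_n]%SET
    & forall i, rounding (n%:R / k%:R : R) #|V i| ].

(* The set of the first i chosen vertices, S_i, where the 0-based v j is the
   vertex chosen at the step that leads from S_j to S_(j+1). *)
Definition chosen (n k : nat) (v : 'I_k -> 'I_n) (i : nat) : {set 'I_n} :=
  [set v j | j : 'I_k & (j < i)%N]%SET.

(* v is a run of the greedy algorithm on G; ties are broken arbitrarily. *)
Definition greedy_run (n k : nat) (G : {set {set 'I_n}})
    (V : 'I_k -> {set 'I_n}) (v : 'I_k -> 'I_n) : Prop :=
  forall i : 'I_k,
    v i \in V i /\
    forall u, u \in V i ->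
      (#|edges_between G [set u]%SET (chosen v i)| <=
       #|edges_between G [set v i]%SET (chosen v i)|)%N.

(* Main.v *)
From Stdlib Require Import BinNat Nnat.
Require Import Defs.
From mathcomp Require Import fintype finset zify ring lra.

(** Let [m = |S_i|] and let [w] be a threshold. For a fixed set [S] of size [m]
    disjoint from [V_i], the degrees into [S] of the vertices of [V_i] are
    independent binomial variables, so they are all below [w] with probability
    at most [(1 - 'C(m, w) / 2 ^ m) ^ |V_i| <= exp (- |V_i| 'C(m, w) / 2 ^ m)].
    As long as ['C(m, w) / 2 ^ m >= n ^ (eps - 1)] this is so small that it
    survives a union bound over all of the at most [n ^ k] sets [S]; hence
    neither the dependence of [S_i] on the graph nor the tie-breaking matters,
    and with high probability the greedy set has at least [\sum_i w_i] edges.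

    The points [(x, y)] with [m = x k], [w = y k] for which the threshold is
    allowed form a convex region, because
    ['C(m, w) * 'C(m', w') <= 'C(m + m', w + w')]. It is thus enough to allow
    the nodes of a polygonal line, and the density is then at least twice the
    area under this line. The exact region gives [0.95114], and an inscribed
    polygon with twelve edges still gives more than [0.951]. *)

Set Implicit Arguments.
Unset Strict Implicit.
Unset Printing Implicit Defensive.

(** * Binomial coefficients along a polygonal line *)

(** Up to the factor [m ^ m] the terms are the weights of the binomial law with parameter [t / m].
    The ratio of consecutive terms compares [(m - i) * t] with [i.+1 * (m - t)], so they increase up
    to [t] and decrease afterwards. *)
Lemma leq_binomial_term_mode (m t j : nat) : t <= m -> j <= m ->
  'C(m, j) * (t ^ j * (m - t) ^ (m - j)) <= 'C(m, t) * (t ^ t * (m - t) ^ (m - t)).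
Proof.
set F := fun j => 'C(m, j) * (t ^ j * (m - t) ^ (m - j)).
rewrite -/(F j) -/(F t) => le_tm.
have ratio i : i < m -> F i.+1 * (i.+1 * (m - t)) = F i * ((m - i) * t).
  move=> lt_im; rewrite /F.
  have := mul_bin_left m i; rewrite (_ : m - i = (m - i.+1).+1); last by lia.
  rewrite !expnS; move: 'C(m, i.+1) 'C(m, i) => b c E.
  rewrite (_ : _ * (i.+1 * _) =
    (i.+1 * b) * (t * t ^ i * (m - t) ^ (m - i.+1) * (m - t))); last by lia.
  by rewrite E; lia.
(* For [t = m] the factor [m - t] in [ratio] is zero and cannot be cancelled, but then every term
   with [j < m] vanishes. *)
case: (ltngtP t m) le_tm => // [lt_tm _|eq_tm _]; last first.
  rewrite /F eq_tm.
  rewrite leq_eqVlt => /predU1P[->//|lt_jm].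
  by rewrite subnn [0 ^ (m - j)]exp0n ?subn_gt0// !muln0.
case: (leqP j t) => [le_jt _|lt_tj le_jm].
  have inc i : i < t -> F i <= F i.+1.
    move=> lt_it; rewrite -(@leq_pmul2r (i.+1 * (m - t))) ?muln_gt0 ?subn_gt0//.
    by rewrite ratio ?(ltn_trans lt_it)// leq_mul2l mulnC leq_mul ?orbT// leq_sub2l// ltnW.
  rewrite -(subKn le_jt); elim: (t - j) (leq_subr j t) => [|d IH] le_dt.
    by rewrite subn0.
  apply: leq_trans (inc _ _) _; first by rewrite subnSK// leq_subr.
  by rewrite subnSK// IH// ltnW.
have dec i : t <= i < m -> F i.+1 <= F i.
  move=> /andP[le_ti lt_im]; rewrite -(@leq_pmul2r (i.+1 * (m - t))) ?muln_gt0 ?subn_gt0//.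
  rewrite ratio// leq_mul2l mulnC leq_mul ?orbT// ?leq_sub2l//.
  by rewrite ltnW// ltnS.
rewrite -(subnKC (ltnW lt_tj)) in le_jm *.
elim: (j - t) le_jm => [|d IH] le_dm; first by rewrite addn0.
rewrite addnS in le_dm *; apply: leq_trans (dec _ _) (IH (ltnW le_dm)).
by rewrite leq_addr.
Qed.

(** By the binomial theorem [m ^ m = (t + (m - t)) ^ m] is a sum of [m.+1] terms, of which the one
    at [t] is the largest. *)
Lemma expn_leq_binomial_mode (m t : nat) : t <= m ->
  m ^ m <= m.+1 * ('C(m, t) * (t ^ t * (m - t) ^ (m - t))).
Proof.
move=> le_tm; rewrite -{1}(subnK le_tm) expnDn.
rewrite -[X in _ <= X * _](card_ord m.+1) -sum_nat_const.
apply: leq_sum => i _; rewrite [X in 'C(_, _) * X]mulnC.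
by rewrite leq_binomial_term_mode// -ltnS.
Qed.

(** The left side is a single term of Vandermonde's sum. *)
Lemma leq_bin_mul (a b c d : nat) : 'C(a, c) * 'C(b, d) <= 'C(a + b, c + d).
Proof.
rewrite -binomial.Vandermonde.
have lt_c : c < (c + d).+1 by rewrite ltnS leq_addr.
by rewrite (bigD1 (Ordinal lt_c))//= addKn leq_addr.
Qed.

(** This is the mode bound at [(x * s, y * s)] after cancelling [s ^ (x * s)]. *)
Lemma expn_leq_bin_block (x y s : nat) : y <= x ->
  (x ^ x) ^ s <= (x * s).+1 * ('C(x * s, y * s) * (y ^ y * (x - y) ^ (x - y)) ^ s).
Proof.
move=> le_yx; case: s => [|s]; first by rewrite !expn0 !muln0 bin0.
have := @expn_leq_binomial_mode (x * s.+1) (y * s.+1) (leq_mul le_yx (leqnn _)).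
rewrite -mulnBl !expnMn -!expnM.
move=> le_mode; rewrite -(@leq_pmul2r (s.+1 ^ (x * s.+1))) ?expn_gt0//.
move: le_mode.
have -> : s.+1 ^ (x * s.+1) = s.+1 ^ (y * s.+1) * s.+1 ^ ((x - y) * s.+1).
  by rewrite -expnD -mulnDl subnKC.
by move/leq_trans; apply; rewrite leq_eqVlt; apply/predU1P; left; lia.
Qed.

(* With [p = (x, y)], for large [s] the probability of [y * s] heads among
   [x * s] fair coin flips is, up to a polynomial factor, the [s]-th power of
   [x ^ x / (2 ^ x * y ^ y * (x - y) ^ (x - y))]: each block of [x] flips costs
   at most [h] bits, and even a factor [a / b] less. Recall [0 ^ 0 = 1]. *)
Definition affordable (a b h : nat) (p : nat * nat) : bool :=
  (p.2 <= p.1) &&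
  (b * (2 ^ p.1 * (p.2 ^ p.2 * (p.1 - p.2) ^ (p.1 - p.2))) <=
   a * (2 ^ h * p.1 ^ p.1)).

Lemma affordable_block (a b h x y s : nat) : affordable a b h (x, y) ->
  b ^ s * 2 ^ (x * s) <= (x * s).+1 * 'C(x * s, y * s) * (a * 2 ^ h) ^ s.
Proof.
case/andP=> /= le_yx; set q := y ^ y * _.
have q_gt0 : 0 < q by rewrite /q muln_gt0 !expn_gt0; lia.
move=> le_cost.
have le_pow : (b * (2 ^ x * q)) ^ s <= (a * (2 ^ h * x ^ x)) ^ s.
  by case: s => // s; rewrite leq_exp2r.
rewrite -(@leq_pmul2r (q ^ s)) ?expn_gt0 ?q_gt0//.
rewrite expnM -!mulnA -!expnMn; apply: leq_trans le_pow _.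
rewrite [in leqLHS]mulnA expnMn.
apply: leq_trans (leq_mul (leqnn _) (expn_leq_bin_block s le_yx)) _.
rewrite !expnMn leq_eqVlt; apply/predU1P; left; lia.
Qed.

(** Convexity of the affordable region: [K - s] blocks of type [p] and [s] of type [p'] are put side
    by side. Each type costs a factor [m.+1], and the [r] leftover flips cost [2 ^ r]. *)
Lemma affordable_mixture (a b h K s r : nat) (p p' : nat * nat) :
  affordable a b h p -> affordable a b h p' -> s <= K ->
  let m := p.1 * (K - s) + p'.1 * s + r in
  b ^ K * 2 ^ m <=
    2 ^ r * m.+1 ^ 2 * 'C(m, p.2 * (K - s) + p'.2 * s) * (a * 2 ^ h) ^ K.
Proof.
case: p p' => [x y] [x' y'] /= ap ap' le_sK; set m := _ + r.
have le1 := affordable_block (K - s) ap; have le2 := affordable_block s ap'.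
have {le1 le2} := leq_mul le1 le2.
have bK c : c ^ K = c ^ (K - s) * c ^ s by rewrite -expnD subnK.
have le_bin : 'C(x * (K - s), y * (K - s)) * 'C(x' * s, y' * s)
    <= 'C(m, y * (K - s) + y' * s).
  by apply: leq_trans (leq_bin_mul _ _ _ _) _; rewrite leq_bin2l// leq_addr.
have le_m1 : (x * (K - s)).+1 <= m.+1 by rewrite ltnS /m; lia.
have le_m2 : (x' * s).+1 <= m.+1 by rewrite ltnS /m; lia.
have := leq_mul (leq_mul le_m1 le_m2) le_bin.
have -> : 2 ^ m = 2 ^ (x * (K - s)) * 2 ^ (x' * s) * 2 ^ r by rewrite -!expnD.
rewrite !bK; move: ((a * _) ^ (K - s)) ((a * _) ^ s) (b ^ (K - s)) (b ^ s) => a1 a2 b1 b2.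
move: (2 ^ (x * (K - s))) (2 ^ (x' * s)) (2 ^ r) => t1 t2 rr.
move: 'C(m, _) 'C(x * (K - s), _) 'C(x' * s, _) m.+1 => c3 c1 c2 m3.
move: (x * _).+1 (x' * s).+1 => m1 m2 le_c le_b.
have := leq_mul le_b (leqnn rr).
rewrite (_ : b1 * t1 * (b2 * t2) * rr = b1 * b2 * (t1 * t2 * rr)); last by lia.
move/leq_trans; apply.
rewrite (_ : _ * rr = (m1 * m2 * (c1 * c2)) * (a1 * a2 * rr)); last by lia.
apply: leq_trans (leq_mul le_c (leqnn _)) _.
by rewrite leq_eqVlt; apply/predU1P; left; lia.
Qed.

(* The polygonal line through the nodes, starting at [p] and dilated by [K]:
   on the segment from [p] to [p'] it takes the value
   [p.2 * (K - s) + p'.2 * s] around the abscissa [p.1 * (K - s) + p'.1 * s]. *)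
Fixpoint profile (K : nat) (p : nat * nat) (nodes : seq (nat * nat)) (m : nat) : nat :=
  if nodes is p' :: nodes' then
    if m < p'.1 * K then
      let s := (m - p.1 * K) %/ (p'.1 - p.1) in p.2 * (K - s) + p'.2 * s
    else profile K p' nodes' m
  else 0.

(** Twice the area under the polygonal line, which keeps it an integer. *)
Fixpoint trapezoids (p : nat * nat) (nodes : seq (nat * nat)) : nat :=
  if nodes is p' :: nodes' then
    (p'.1 - p.1) * (p.2 + p'.2) + trapezoids p' nodes'
  else 0.

Definition node_lt : rel (nat * nat) := fun p p' => p.1 < p'.1.

Lemma profile_affordable (a b h D K : nat) (p : nat * nat) nodes (m : nat) :
  path node_lt p nodes -> all (affordable a b h) (p :: nodes) ->
  (last p nodes).1 <= D -> p.1 * K <= m < (last p nodes).1 * K ->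
  b ^ K * 2 ^ m <= 2 ^ D * m.+1 ^ 2 * 'C(m, profile K p nodes m) * (a * 2 ^ h) ^ K.
Proof.
elim: nodes p => [|p' nodes IH] p /=; first by move=> _ _ _ /andP[]; lia.
move=> /andP[lt_pp' path_nodes] /andP[ap all_ap] le_D /andP[le_pm lt_m].
case: ltnP => [lt_mp'|le_p'm]; last by rewrite IH// le_p'm.
have ap' : affordable a b h p' by case/andP: all_ap.
have le_p'D : p'.1 <= D.
  apply: leq_trans le_D; elim: (nodes) (p') path_nodes => //= q qs IHq r.
  by case/andP=> /ltnW le_rq /IHq; apply: leq_trans.
set d := p'.1 - p.1; have d_gt0 : 0 < d by rewrite subn_gt0.
(* Moving from abscissa [p.1 * K] to [m] turns [s] blocks of type [p] into blocks of type [p'], each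
   gaining [d] flips; the remaining [r < d <= D] flips are left over. *)
set s := (m - p.1 * K) %/ d; set r := (m - p.1 * K) %% d.
have lt_sK : s < K.
  by rewrite ltn_divLR// /d mulnBr [K * p'.1]mulnC [K * p.1]mulnC ltn_sub2r// (leq_ltn_trans le_pm).
have m_eq : m = p.1 * (K - s) + p'.1 * s + r.
  have := divn_eq (m - p.1 * K) d; rewrite -/s -/r /d mulnBr.
  have : p.1 * s <= p'.1 * s by rewrite leq_mul2r ltnW ?orbT.
  have : p.1 * s <= p.1 * K by rewrite leq_mul2l ltnW ?orbT.
  by rewrite mulnBr; lia.
have := affordable_mixture r ap ap' (ltnW lt_sK); rewrite /= -m_eq.
move/leq_trans; apply; rewrite !leq_mul2r leq_exp2l//.
by rewrite (leq_trans (ltnW (ltn_pmod _ d_gt0)))//; lia.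
Qed.

Lemma sum_divn (d K : nat) (f : nat -> nat) : 0 < d ->
  \sum_(0 <= m < d * K) f (m %/ d) = d * \sum_(0 <= s < K) f s.
Proof.
move=> d_gt0; elim: K => [|K IH]; first by rewrite muln0 !big_geq ?muln0.
rewrite mulnS addnC (big_cat_nat (n := d * K)) ?leq_addr//= IH big_nat_recr//= mulnDr.
congr (_ + _); rewrite -{1}[d * K]add0n big_addn addKn.
rewrite (eq_big_nat _ _ (F2 := fun=> f K)) ?sum_nat_const_nat ?subn0//.
by move=> i /andP[_ lt_id]; rewrite mulnC divnDMl// divn_small.
Qed.

(** Each value of [s] occurs [d] times, so a segment contributes [d] times the sum of
    [p.2 * (K - s) + p'.2 * s] over [s < K]. The sums of [s] and of [K - s] are both at least
    [K * K.-1 / 2]. *)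
Lemma sum_profile (K : nat) (p : nat * nat) nodes : path node_lt p nodes ->
  K * K.-1 * trapezoids p nodes <=
  2 * \sum_(p.1 * K <= m < (last p nodes).1 * K) profile K p nodes m.
Proof.
elim: nodes p => [|p' nodes IH] p /=; first by rewrite muln0.
move=> /andP[lt_pp' path_nodes].
have le_last : p'.1 <= (last p' nodes).1.
  elim: (nodes) (p') path_nodes => //= q qs IHq r.
  by case/andP=> /ltnW le_rq /IHq; apply: leq_trans.
have le_pp' : p.1 * K <= p'.1 * K by rewrite leq_mul2r ltnW ?orbT.
have le_p'last : p'.1 * K <= (last p' nodes).1 * K by rewrite leq_mul2r le_last orbT.
rewrite (big_cat_nat (n := p'.1 * K))//= [in leqLHS]mulnDr [in leqRHS]mulnDr.
apply: leq_add; last first.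
  apply: leq_trans (IH _ path_nodes) _; rewrite leq_mul2l /=.
  rewrite leq_eqVlt; apply/predU1P; left; apply: eq_big_nat => m /andP[le_m _].
  by rewrite ltnNge le_m.
set d := p'.1 - p.1; have d_gt0 : 0 < d by rewrite subn_gt0.
rewrite (eq_big_nat _ _ (F2 := fun m =>
   (fun s => p.2 * (K - s) + p'.2 * s) ((m - p.1 * K) %/ d))); last first.
  by move=> m /andP[_ ->].
rewrite -[p.1 * K]add0n big_addn add0n -mulnBl -/d.
under eq_bigr do rewrite addnK.
rewrite (sum_divn _ (fun s => p.2 * (K - s) + p'.2 * s))//.
rewrite big_split /= -!big_distrr /=.
have sum1 : 2 * \sum_(0 <= s < K) s = K * K.-1.
  by rewrite bin2_sum mul_bin_left bin1 subn1 mulnC.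
have sum2 : \sum_(0 <= s < K) (K - s) + \sum_(0 <= s < K) s = K * K.
  rewrite -big_split /= -{3}[K]subn0 -sum_nat_const_nat.
  by apply: eq_big_nat => s /andP[_ lt_sK]; rewrite subnK// ltnW.
move: (\sum_(0 <= s < K) s) (\sum_(0 <= s < K) (K - s)) sum1 sum2 => A B sum1 sum2.
have le_KB : K * K.-1 <= 2 * B by nia.
have := leq_mul (leqnn (d * p.2)) le_KB.
have := leq_mul (leqnn (d * p'.2)) (eq_leq (esym sum1)).
by move: (K * K.-1) => kk; lia.
Qed.

(** The last fewer than [D] steps, beyond the dilated line, get the trivial threshold 0. *)
Definition threshold (D : nat) (nodes : seq (nat * nat)) (k i : nat) : nat :=
  if i < D * (k %/ D) then profile (k %/ D) (0, 0) nodes i else 0.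

(** [D = 2 * h] reflects [k = 2 log n]: the [K] blocks cost [h * K <= k / 2] bits, about [log n],
    which a class of about [n / k] vertices can pay. The surplus [(b / a) ^ K] remains. *)
Lemma threshold_bin (a b h : nat) (nodes : seq (nat * nat)) (n k i N : nat) :
  let D := (last (0, 0) nodes).1 in
  path node_lt (0, 0) nodes -> all (affordable a b h) ((0, 0) :: nodes) ->
  D = 2 * h -> i < k -> 0 < threshold D nodes k i ->
  2 ^ k <= 2 * n ^ 2 -> n <= 2 * k * N ->
  b ^ (k %/ D) * 2 ^ i <=
  2 ^ D.+2 * k ^ 3 * a ^ (k %/ D) * (N * 'C(i, threshold D nodes k i)).
Proof.
move=> D path_nodes aff D_eq lt_ik; rewrite /threshold; case: (ltnP i (D * _)) => // lt_i _ k_n n_N.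
set K := k %/ D.
have := profile_affordable (K := K) (m := i) path_nodes aff (leqnn _) lt_i.
rewrite -/D; move: 'C(_, _) => c le_c.
have le_hK : (2 ^ h) ^ K <= 2 * n.
  have le_sq : 2 ^ k <= (2 * n) ^ 2 by rewrite expnMn; lia.
  rewrite -leq_sqr -!expnM; apply: leq_trans le_sq.
  by rewrite leq_exp2l//; have := leq_trunc_div k D; rewrite D_eq; lia.
apply: leq_trans le_c _; rewrite expnMn.
apply: (@leq_trans (2 ^ D * k ^ 2 * c * (a ^ K * (2 * (2 * k * N))))).
  apply: leq_mul; last by rewrite leq_mul// (leq_trans le_hK)// leq_mul2l.
  by rewrite leq_mul// leq_mul// leq_sqr.
rewrite !expnS expn0; move: (2 ^ D) (a ^ K) => t s.
by rewrite leq_eqVlt; apply/predU1P; left; lia.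
Qed.

Lemma sum_threshold (nodes : seq (nat * nat)) (u v k : nat) :
  let D := (last (0, 0) nodes).1 in
  path node_lt (0, 0) nodes -> 0 < D -> u * D ^ 2 < v * trapezoids (0, 0) nodes ->
  4 * (u * D ^ 2) < k %/ D ->
  u * 'C(k, 2) <= v * \sum_(i < k) threshold D nodes k i.
Proof.
move=> D path_nodes D_gt0; set K := k %/ D; set T := trapezoids _ _ => lt_T lt_K.
have le_DK : D * K <= k by rewrite mulnC leq_trunc_div.
have sum_ge : K * K.-1 * T <= 2 * \sum_(i < k) threshold D nodes k i.
  apply: leq_trans (sum_profile K path_nodes) _; rewrite [(0, 0).1 * K]mul0n.
  rewrite leq_mul2l /= -(big_mkord xpredT (threshold D nodes k)).
  rewrite [leqRHS](big_cat_nat (n := D * K))//= -/D; apply: leq_trans (leq_addr _ _).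
  rewrite leq_eqVlt; apply/predU1P; left; apply: eq_big_nat => i /andP[_ lt_i].
  by rewrite /threshold lt_i.
have bin_le : 2 * 'C(k, 2) <= (D * K.+1) ^ 2.
  rewrite mul_bin_left bin1 expnS expn1 leq_mul//.
    by rewrite (leq_trans (leq_subr _ _))// ltnW// mulnC ltn_ceil.
  by rewrite ltnW// mulnC ltn_ceil.
rewrite expnMn in bin_le.
move: (\sum_(_ < _) _) 'C(k, 2) sum_ge bin_le => W c sum_ge bin_le.
(* The strict inequality [lt_T] between integers leaves a slack of one unit, which absorbs the ratio
   of [K.+1 ^ 2] to [K * K.-1] once [K > 4 * (u * D ^ 2)]. *)
have h1 : u * D ^ 2 * K.+1 ^ 2 <= (u * D ^ 2).+1 * (K * K.-1).
  by move: (u * D ^ 2) lt_K => x; case: (K) => // j; rewrite -pred_Sn !expnS expn0; nia.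
rewrite -(@leq_pmul2l 2)//.
apply: (@leq_trans (u * (D ^ 2 * K.+1 ^ 2))); first by rewrite mulnCA leq_mul.
rewrite mulnA; apply: leq_trans h1 _.
apply: (@leq_trans (v * T * (K * K.-1))); first by rewrite leq_mul2r lt_T orbT.
by have := leq_mul (leqnn v) sum_ge; move: K.-1 => j; lia.
Qed.


(** * Checking the nodes in binary arithmetic *)

(** A copy of [affordable] on binary numbers, since powers such as [408 ^ 408] are out of reach in
    unary. *)
Definition affordableN (a b h : N) (p : N * N) : bool :=
  let: (x, y) := p in
  N.leb y x && N.leb (b * (2 ^ x * (y ^ y * (x - y) ^ (x - y))))%num (a * (2 ^ h * x ^ x))%num.

Lemma to_nat_pow (a b : N) : N.to_nat (a ^ b) = N.to_nat a ^ N.to_nat b.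
Proof.
rewrite Nnat.N2Nat.inj_pow; elim: (N.to_nat b) => //= n ->.
by rewrite expnS multE.
Qed.

Lemma affordableNP (a b h : N) (p : N * N) : affordableN a b h p ->
  affordable (N.to_nat a) (N.to_nat b) (N.to_nat h) (N.to_nat p.1, N.to_nat p.2).
Proof.
case: p => x y /andP[/N.leb_le le_yx /N.leb_le le_cost]; apply/andP; split=> /=.
  by lia.
rewrite (_ : N.to_nat x - N.to_nat y = N.to_nat (x - y)); last by lia.
rewrite (_ : 2 = N.to_nat 2)// -!to_nat_pow.
by move: (_ ^ x)%num (_ ^ h)%num (_ ^ y)%num (_ ^ (x - y))%num (_ ^ x)%num le_cost; lia.
Qed.

(* Found by computing the upper convex hull of the lattice points with abscissa
   at most 408 that are affordable with [h = 204] bits, and dropping vertices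
   as long as the area allows. *)
Definition nodesN : seq (N * N) :=
  [:: (203, 203); (213, 212); (227, 224); (250, 243); (275, 263); (298, 281);
      (311, 291); (336, 310); (348, 319); (375, 339); (401, 358); (408, 363)]%num.

Definition greedy_nodes : seq (nat * nat) :=
  [seq (N.to_nat p.1, N.to_nat p.2) | p <- nodesN].

(** The ratio [201 / 200] only has to exceed 1: its [K]-th power is exponential in [k] and beats
    every polynomial loss. *)
Lemma greedy_nodes_affordable :
  all (affordable 200 201 204) ((0, 0) :: greedy_nodes).
Proof.
have /allP aff : all (affordableN 200 201 204) ((0, 0) :: nodesN)%num by vm_compute.
rewrite -[_ :: _]/[seq (N.to_nat p.1, N.to_nat p.2) | p <- (0, 0)%num :: nodesN].
by apply/allP => _ /mapP[p /aff + ->]; apply: affordableNP.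
Qed.

Lemma greedy_nodes_path : path node_lt (0, 0) greedy_nodes.
Proof. by []. Qed.

Lemma trapezoids_greedy_nodes :
  951 * 408 ^ 2 < 1000 * trapezoids (0, 0) greedy_nodes.
Proof. by rewrite /greedy_nodes /trapezoids /=; lia. Qed.

(** * Counting graphs *)

(** Independence in counting form: [G] corresponds bijectively to the pair of [G :&: F] and
    [G :\: F]. *)
Lemma card_powerset_split (T : finType) (E F : {set T}) (a b : pred {set T}) :
  F \subset E ->
  #|[set G in powerset E | a (G :&: F) && b (G :\: F)]%SET| =
  #|[set G in powerset F | a G]%SET| * #|[set G in powerset (E :\: F) | b G]%SET|.
Proof.
move=> sFE; rewrite -cardsX.
rewrite -(card_in_imset (f := fun G : {set T} => (G :&: F, G :\: F)%SET)).
  2: by move=> G H _ _ [eqI eqD]; rewrite -(setID G F) eqI eqD setID.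
apply: eq_card => -[H H']; rewrite inE !inE /=; apply/imsetP/andP => [[G]|].
  rewrite !inE => /andP[sGE /andP[aG bG]] [-> ->].
  by rewrite aG bG !andbT subsetIr setSD.
move=> [/andP[sHF aH] /andP[]]; rewrite subsetD => /andP[sH'E dH'F bH'].
have EF : (H :|: H') :&: F = H.
  rewrite setIUl (setIidPl sHF); move: dH'F; rewrite -setI_eq0 => /eqP->.
  by rewrite setU0.
have ED : (H :|: H') :\: F = H'.
  rewrite setDUl; move: (sHF); rewrite -setD_eq0 => /eqP->.
  by rewrite set0U; apply/setDidPl.
exists (H :|: H'); last by rewrite EF ED.
by rewrite !inE EF ED aH bH' !andbT subUset sH'E (subset_trans sHF).
Qed.

Lemma card_small_subsets (T : finType) (F : {set T}) (w : nat) :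
  #|[set G in powerset F | #|G| < w]%SET| <= 2 ^ #|F| - 'C(#|F|, w).
Proof.
have E : [set G in powerset F | #|G| == w]%SET =
    [set G : {set T} | G \subset F & #|G| == w]%SET.
  by apply/setP => G; rewrite !inE.
rewrite -cards_draws -card_powerset -E.
have sub : [set G in powerset F | #|G| == w]%SET \subset powerset F.
  by apply/subsetP => G; rewrite inE => /andP[].
rewrite -[X in X - _](cardsID [set G in powerset F | #|G| == w]%SET).
rewrite (setIidPr sub) addKn; apply/subset_leq_card/subsetP => G.
by rewrite !inE => /andP[-> lt_w]; rewrite andbT /= neq_ltn lt_w.
Qed.

(** The traces of [G] on disjoint blocks are independent; the induction splits off one block at a
    time. Denominators are multiplied out to stay within the natural numbers. *)
Lemma card_all_small (T I : finType) (F : I -> {set T}) (m w : nat)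
    (U : {set I}) (E : {set T}) :
  {in U &, forall u u', u != u' -> [disjoint F u & F u']} ->
  {in U, forall u, (F u \subset E) /\ (#|F u| = m)} ->
  #|[set G in powerset E | [forall u in U, #|G :&: F u| < w]]%SET| * (2 ^ m) ^ #|U|
    <= 2 ^ #|E| * (2 ^ m - 'C(m, w)) ^ #|U|.
Proof.
have [N] := ubnP #|U|; elim: N => // N IH in U E *.
rewrite ltnS => leUN dF sF; have [->|[u uU]] := set_0Vmem U.
  rewrite cards0 !expn0 !muln1 -card_powerset; apply/subset_leq_card/subsetP => G.
  by rewrite inE => /andP[].
have [sFE cF] := sF u uU.
have dFu u' : u' \in U :\ u -> [disjoint F u' & F u].
  by rewrite !inE => /andP[neq u'U]; apply: dF.
pose a (H : {set T}) := #|H| < w.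
pose b (H : {set T}) := [forall u' in U :\ u, #|H :&: F u'| < w].
have -> : [set G in powerset E | [forall u in U, #|G :&: F u| < w]]%SET =
    [set G in powerset E | a (G :&: F u) && b (G :\: F u)]%SET.
  apply/setP => G; rewrite !inE; congr (_ && _).
  have eqI u' : u' \in U :\ u -> (G :\: F u) :&: F u' = G :&: F u'.
    move/dFu => d; rewrite setIDAC; apply/setDidPl.
    by apply: disjointWl d; apply: subsetIr.
  apply/forall_inP/andP => [H|[Hu /forall_inP H] u' u'U].
    split; first exact: H; apply/forall_inP => u' u'U; rewrite eqI//.
    by apply: H; case/setD1P: u'U.
  have [->//|neq] := eqVneq u' u.
  by rewrite -eqI ?H// !inE ?neq.
rewrite (card_powerset_split a b sFE) [#|U|](cardsD1 u) uU add1n !expnS.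
have := IH (U :\ u) (E :\: F u).
have -> : #|U :\ u| < N by move: leUN; rewrite (cardsD1 u U) uU.
move=> /(_ isT); have H1 : {in U :\ u &, forall u0 u' : I, u0 != u' -> [disjoint F u0 & F u']}.
  by move=> x y /setD1P[_ xU] /setD1P[_ yU]; apply: dF.
have H2 : {in U :\ u, forall u0, F u0 \subset E :\: F u /\ #|F u0| = m}.
  move=> x xU; have /setD1P[_ /sF[sx ->]] := xU; split=> //.
  by rewrite subsetD sx dFu.
move=> /(_ H1 H2); have := card_small_subsets (F u) w; rewrite cF.
have -> : 2 ^ #|E| = 2 ^ #|E :\: F u| * 2 ^ m.
  by rewrite -expnD cardsDS// cF subnK// -cF subset_leq_card.
move: (2 ^ m) (2 ^ m - _) (2 ^ #|E :\: F u|) ((2 ^ m) ^ _) ((2 ^ m - _) ^ _).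
move=> t q e x y; move: #|_| #|_| => B A le1 le2.
rewrite (_ : A * B * (t * x) = A * (B * x) * t); last by lia.
rewrite (_ : e * t * (q * y) = q * (e * y) * t); last by lia.
by rewrite leq_mul2r leq_mul ?orbT.
Qed.

Lemma leq_bin_expn (n i : nat) : 'C(n, i) <= n ^ i.
Proof.
elim: i => [|i IH] in n *; first by rewrite bin0.
apply: (@leq_trans (i.+1 * 'C(n, i.+1))); first by rewrite leq_pmull.
rewrite -mul_bin_diag expnS leq_mul2l (leq_trans (IH _)) ?orbT//.
by case: i {IH} => // i; rewrite leq_exp2r// leq_pred.
Qed.

(** * Stars and the edges found by the greedy algorithm *)

(** The potential edges from [u] to [S]. For distinct [u] outside [S] they are disjoint, which makes
    the degrees into [S] independent. *)
Definition star (n : nat) (u : 'I_n) (S : {set 'I_n}) : {set {set 'I_n}} :=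
  [set [set u; s] | s in S]%SET.

Lemma edges_between_star (n : nat) (G : {set {set 'I_n}}) (u : 'I_n) (S : {set 'I_n}) :
  edges_between G [set u]%SET S = G :&: star u S.
Proof.
apply/setP => e; rewrite !inE; congr (_ && _); apply/exists_inP/imsetP.
  by move=> [x /set1P-> /exists_inP[s sS /eqP->]]; exists s.
by move=> [s sS ->]; exists u; rewrite ?set11//; apply/exists_inP; exists s.
Qed.

Lemma card_star (n : nat) (u : 'I_n) (S : {set 'I_n}) : u \notin S ->
  #|star u S| = #|S|.
Proof.
move=> uS; apply: card_in_imset => s s' sS s'S /setP/(_ s).
rewrite !inE eqxx orbT => /esym/orP[]/eqP// su.
by rewrite -su sS in uS.
Qed.

Lemma star_sub_vpairs (n : nat) (u : 'I_n) (S : {set 'I_n}) : u \notin S ->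
  star u S \subset vpairs n.
Proof.
move=> uS; apply/subsetP => e /imsetP[s sS ->]; rewrite inE cards2.
by have -> : u != s by apply: contraNneq uS => ->.
Qed.

Lemma disjoint_star (n : nat) (u u' : 'I_n) (S : {set 'I_n}) :
  u \notin S -> u != u' -> [disjoint star u S & star u' S].
Proof.
move=> uS neq; rewrite disjoint_subset; apply/subsetP => e /imsetP[s sS ->].
rewrite inE; apply/imsetP => -[s' s'S /setP/(_ u)].
rewrite !inE eqxx (negPf neq) => /esym/= /eqP us'.
by rewrite us' s'S in uS.
Qed.

Lemma chosenS (n k : nat) (v : 'I_k -> 'I_n) (i : 'I_k) :
  chosen v i.+1 = v i |: chosen v i.
Proof.
apply/setP => x; rewrite !inE; apply/imsetP/orP.
  move=> [j]; rewrite inE ltnS leq_eqVlt => /predU1P[/val_inj-> ->|lt_ji ->]; [by left|right].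
  by apply/imsetP; exists j; rewrite ?inE.
move=> [/eqP->|/imsetP[j]]; first by exists i; rewrite ?inE.
by rewrite inE => lt_ji ->; exists j; rewrite // inE ltnW.
Qed.

Section Transversal.
Variables (n k : nat) (V : 'I_k -> {set 'I_n}) (v : 'I_k -> 'I_n).
Hypothesis V_disjoint : forall i j, i != j -> [disjoint V i & V j].
Hypothesis v_in : forall i, v i \in V i.

Lemma transversal_inj : injective v.
Proof.
move=> i j eq_ij; apply/eqP; apply: contraT => /V_disjoint/disjointFr/(_ (v_in i)).
by rewrite eq_ij v_in.
Qed.

Lemma card_chosen (i : nat) : i <= k -> #|chosen v i| = i.
Proof.
move=> le_ik; rewrite card_imset; last exact: transversal_inj.
rewrite -sum1_card (eq_bigl (fun j : 'I_k => j < i)); last by move=> j; rewrite inE.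
by rewrite -(big_ord_widen _ (fun=> 1) le_ik) sum_nat_const card_ord muln1.
Qed.

Lemma chosen_disjoint (i : 'I_k) : [disjoint chosen v i & V i].
Proof.
rewrite disjoint_subset; apply/subsetP => x /imsetP[j]; rewrite !inE => lt_ji ->.
by rewrite (disjointFr (V_disjoint _) (v_in j))// -val_eqE neq_ltn lt_ji.
Qed.

(** Each edge is counted at the step that adds its later endpoint, hence only once. *)
Lemma leq_sum_edges_chosen (G : {set {set 'I_n}}) :
  \sum_(i < k) #|edges_between G [set v i]%SET (chosen v i)| <=
  #|edges_between G (chosen v k) (chosen v k)|.
Proof.
suff H j : j <= k -> \sum_(i < k | i < j) #|edges_between G [set v i]%SET (chosen v i)| <=
    #|edges_between G (chosen v j) (chosen v j)|.
  by apply: leq_trans (H k (leqnn k)); rewrite [leqRHS](eq_bigl predT)// => i; rewrite ltn_ord.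
elim: j => [|j IH] lt_jk; first by rewrite big_pred0.
pose i := Ordinal lt_jk; rewrite (bigD1 i)//=.
rewrite (eq_bigl (fun i0 : 'I_k => i0 < j)); last first.
  by move=> i0 /=; rewrite -val_eqE ltnS (ltn_neqAle i0 j) andbC.
apply: leq_trans (leq_add (leqnn _) (IH (ltnW lt_jk))) _.
have vi : v i \notin chosen v j.
  by have /disjointFl -> := chosen_disjoint i.
rewrite -[j]/(val i) in IH vi *; rewrite chosenS edges_between_star -cardsUI.
rewrite (_ : #|_ :&: _| = 0) ?addn0; last first.
  apply/eqP; rewrite cards_eq0 setI_eq0 disjoint_subset; apply/subsetP => e.
  rewrite !inE => /andP[eG /imsetP[s sS ->]]; rewrite negb_and; apply/orP; right.
  apply/exists_inP => -[a aS /exists_inP[b bS /eqP/setP/(_ (v i))]].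
  by rewrite !inE eqxx => /esym/orP[]/eqP E; rewrite E ?aS ?bS in vi.
apply/subset_leq_card/subsetP => e; rewrite !inE => /orP[] /andP[-> /=].
  move=> /imsetP[s sS ->]; apply/exists_inP; exists (v i); rewrite ?setU11//.
  by apply/exists_inP; exists s; rewrite ?setU1r.
move=> /exists_inP[a aS /exists_inP[b bS e_eq]]; apply/exists_inP; exists a; rewrite ?setU1r//.
by apply/exists_inP; exists b; rewrite ?setU1r.
Qed.

End Transversal.

(** If any vertex of [V i] reaches the threshold, so does the greedy choice, being a maximizer. *)
Lemma leq_edges_greedy (n k : nat) (G : {set {set 'I_n}}) (V : 'I_k -> {set 'I_n})
    (v : 'I_k -> 'I_n) (w : nat -> nat) :
  (forall i j, i != j -> [disjoint V i & V j]) -> greedy_run G V v ->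
  (forall i : 'I_k, ~~ [forall u in V i, #|G :&: star u (chosen v i)| < w i]) ->
  \sum_(i < k) w i <= #|edges_between G (chosen v k) (chosen v k)|.
Proof.
move=> dV run good; have v_in i := (run i).1.
apply: leq_trans (leq_sum_edges_chosen dV v_in G); apply: leq_sum => i _.
have /forall_inPn[u uV] := good i; rewrite -leqNgt -edges_between_star.
by move=> /leq_trans; apply; apply: (run i).2.
Qed.

(** * Failure probability and union bound *)

Local Open Scope ring_scope.

(** At [p = 1/2] all graphs have the same mass, so probabilities are counts. *)
Lemma gnp_Pr_half (R : realType) (n : nat) (A : pred {set {set 'I_n}}) :
  gnp_Pr (2^-1 : R) A = #|[set G in graphs n | A G]%SET|%:R / 2 ^+ #|vpairs n|.
Proof.
rewrite /gnp_Pr (eq_bigr (fun=> (2 ^+ #|vpairs n|)^-1)) => [|G _]; last first.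
  rewrite /gnp_mass -exprVn -prodr_const; apply: eq_bigr => e _.
  by case: ifP => // _; lra.
rewrite sumr_const mulr_natl; congr (_ *+ _).
by apply: eq_card => G; rewrite inE.
Qed.

Lemma gnp_Pr_half_le1 (R : realType) (n : nat) (A : pred {set {set 'I_n}}) :
  gnp_Pr (2^-1 : R) A <= 1.
Proof.
rewrite gnp_Pr_half ler_pdivrMr ?exprn_gt0// mul1r -natrX ler_nat -card_powerset.
by apply/subset_leq_card/subsetP => G; rewrite inE => /andP[].
Qed.

Lemma leq_card_bigcup (T I : finType) (P : pred I) (F : I -> {set T}) :
  (#|\bigcup_(i | P i) F i| <= \sum_(i | P i) #|F i|)%N.
Proof.
elim/big_ind2: _ => [|x A y B le_x le_y|//]; first by rewrite cards0.
by rewrite (leq_trans (leq_card_setU _ _).1) ?leq_add.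
Qed.

Lemma leq_bin_exp2 (m w : nat) : ('C(m, w) <= 2 ^ m)%N.
Proof.
case: (leqP w m) => [le_wm|lt_mw]; last by rewrite bin_small.
rewrite -ltnS in le_wm; rewrite -[2%N]/(1 + 1)%N expnDn (bigD1 (Ordinal le_wm))//=.
by rewrite !exp1n !muln1 leq_addr.
Qed.

Lemma greedy_failure_card (R : realType) (n : nat) (w : nat) (U S : {set 'I_n}) :
  [disjoint S & U] ->
  #|[set G in graphs n | [forall u in U, #|G :&: star u S| < w]%N]%SET|%:R <=
  (2 ^+ #|vpairs n| * (1 - 'C(#|S|, w)%:R / 2 ^+ #|S|) ^+ #|U| : R).
Proof.
move=> dSU; have uS u : u \in U -> u \notin S by move=> uU; rewrite (disjointFl dSU).
set m := #|S|; set B := [set G in _ | _]%SET.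
have : (#|B| * (2 ^ m) ^ #|U| <= 2 ^ #|vpairs n| * (2 ^ m - 'C(m, w)) ^ #|U|)%N.
  apply: card_all_small => [u u' uU _ neq|u uU]; first exact: disjoint_star (uS _ uU) neq.
  by rewrite star_sub_vpairs ?card_star ?uS.
have pos : 0 < (2 ^+ m : R) by rewrite exprn_gt0.
rewrite -(ler_nat R) !(natrM, natrX) natrB ?leq_bin_exp2// natrX.
rewrite -ler_pdivlMr ?exprn_gt0// -mulrA -expr_div_n mulrBl divff ?gt_eqF//.
Qed.

(* The failure events range over all sets [S] of the right size, not only over
   the greedy ones, which depend on the whole graph through the tie-breaking. *)
Lemma greedy_success_Pr (R : realType) (n k : nat) (V : 'I_k -> {set 'I_n})
    (v : {set {set 'I_n}} -> 'I_k -> 'I_n) (w : nat -> nat) (eps : R) :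
  (0 < n)%N -> (forall i j, i != j -> [disjoint V i & V j]) ->
  (forall G, G \in graphs n -> greedy_run G V (v G)) ->
  (forall i : 'I_k, (0 < w i)%N ->
    (1 - 'C(i, w i)%:R / 2 ^+ i) ^+ #|V i| <= eps) ->
  0 <= eps ->
  1 - k%:R * n%:R ^+ k * eps <=
  gnp_Pr (2^-1 : R) (fun G => (#|chosen (v G) k| == k) &&
    (\sum_(i < k) w i <= #|edges_between G (chosen (v G) k) (chosen (v G) k)|)%N).
Proof.
move=> n_gt0 dV run small eps_ge0; rewrite gnp_Pr_half.
set good := [set G in _ | _]%SET; set N := 2 ^+ #|vpairs n|.
have N_gt0 : 0 < N :> R by rewrite exprn_gt0.
pose bad (i : 'I_k) (S : {set 'I_n}) :=
  [set G in graphs n | [forall u in V i, #|G :&: star u S| < w i]%N]%SET.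
pose range (i : 'I_k) (S : {set 'I_n}) := (#|S| == i) && [disjoint S & V i].
have cover : graphs n \subset
    good :|: \bigcup_(i : 'I_k | (0 < w i)%N) \bigcup_(S | range i S) bad i S.
  apply/subsetP => G Gg; rewrite inE; case: (boolP (G \in good)) => //= nG.
  have v_in i := (run G Gg i).1.
  have [H|/forallPn[i]] := boolP
     [forall i : 'I_k, ~~ [forall u in V i, #|G :&: star u (chosen (v G) i)| < w i]%N].
    move: nG; rewrite inE Gg (card_chosen dV v_in (leqnn k)) eqxx /=.
    by rewrite (leq_edges_greedy dV (run G Gg))// => i; move/forallP: H.
  rewrite negbK => bi; apply/bigcupP; exists i.
    (* A step with threshold 0 cannot fail, because [V i] contains [v G i]. *)
    by move/forall_inP: bi => /(_ _ (v_in i)); apply: leq_trans.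
  apply/bigcupP; exists (chosen (v G) i); last by rewrite inE Gg.
  by rewrite /range (card_chosen dV v_in (ltnW (ltn_ord i))) eqxx chosen_disjoint.
have le_bad (i : 'I_k) S : (0 < w i)%N -> range i S -> #|bad i S|%:R <= N * eps.
  move=> wi /andP[/eqP cS dS]; apply: le_trans (greedy_failure_card R _ dS) _.
  by rewrite ler_pM2l// cS small.
have le_i (i : 'I_k) : (0 < w i)%N ->
    (\sum_(S | range i S) #|bad i S|)%:R <= n%:R ^+ k * (N * eps).
  move=> wi; rewrite natr_sum; apply: (@le_trans _ _ (\sum_(S | range i S) N * eps)).
    by apply: ler_sum => S; apply: le_bad.
  rewrite sumr_const -[leLHS]mulr_natl ler_wpM2r ?mulr_ge0 ?(ltW N_gt0)//.
  rewrite -natrX ler_nat; apply: (@leq_trans 'C(n, i)).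
    rewrite -[X in 'C(X, _)](card_ord n) -card_draws; apply/subset_leq_card/subsetP => S.
    by rewrite inE => /andP[].
  by rewrite (leq_trans (leq_bin_expn _ _))// leq_pexp2l// ltnW.
have : N <= #|good|%:R + k%:R * (n%:R ^+ k * (N * eps)).
  rewrite {1}/N -natrX -card_powerset.
  apply: (@le_trans _ _ (#|good| + \sum_(i : 'I_k | (0 < w i)%N) \sum_(S | range i S) #|bad i S|)%:R).
    rewrite ler_nat (leq_trans (subset_leq_card cover))//.
    rewrite (leq_trans (leq_card_setU _ _).1)// leq_add2l.
    rewrite (leq_trans (leq_card_bigcup _ _))//; apply: leq_sum => i _.
    exact: leq_card_bigcup.
  rewrite natrD lerD2l natr_sum -[X in X%:R * _](card_ord k) mulr_natl -sumr_const.
  rewrite [leLHS]big_mkcond; apply: ler_sum => i _; case: ifP => [/le_i//|_].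
  by rewrite !mulr_ge0 ?exprn_ge0 ?(ltW N_gt0).
rewrite ler_pdivlMr// mulrBl mul1r lerBlDr; congr (_ <= _ + _); ring.
Qed.

Local Open Scope classical_set_scope.

(** * Asymptotics *)

(** Write [q ^+ (k %/ D)] as an exponential and keep the term of degree [d.+1] of its series. The 2
    in [g] makes up for the floor in [k %/ D]. *)
Lemma poly_le_exp_near (R : realType) (q c : R) (d D : nat) : 1 < q -> (0 < D)%N ->
  \forall k \near \oo, c * k%:R ^+ d <= q ^+ (k %/ D).
Proof.
move=> q_gt1 D_gt0; have lnq_gt0 := ln_gt0 q_gt1.
have Dr_gt0 : 0 < D%:R :> R by rewrite ltr0n.
set g := ln q / (2 * D%:R); have g_gt0 : 0 < g by rewrite divr_gt0// mulr_gt0.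
set f : R := (d.+1)`!%:R; have f_gt0 : 0 < f by rewrite ltr0n fact_gt0.
near=> k.
have k_ge : c * f / g ^+ d.+1 <= k%:R by near: k; exact: nbhs_infty_ger.
have K_gt0 : (0 < k %/ D)%N by rewrite divn_gt0//; near: k; exact: nbhs_infty_ge.
have k_le : k%:R <= 2 * D%:R * (k %/ D)%:R :> R.
  rewrite -!natrM ler_nat; have := ltn_ceil k D_gt0; nia.
rewrite -[q]lnK ?posrE ?(lt_trans ltr01 q_gt1)// -expRM_natl.
have x_ge : k%:R * g <= (k %/ D)%:R * ln q.
  have -> : (k %/ D)%:R * ln q = 2 * D%:R * (k %/ D)%:R * g.
    by rewrite /g; field; rewrite gt_eqF.
  by rewrite ler_pM2r.
have kg_ge0 : 0 <= k%:R * g by rewrite mulr_ge0 ?ler0n ?(ltW g_gt0).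
apply: le_trans (expR_ge1Dxn d (le_trans kg_ge0 x_ge)).
apply: (@le_trans _ _ ((k%:R * g) ^+ d.+1 / f)).
  have -> : (k%:R * g) ^+ d.+1 / f = k%:R ^+ d * (k%:R * (g ^+ d.+1 / f)).
    by rewrite exprMn [k%:R ^+ d.+1]exprSr !mulrA.
  rewrite [leLHS]mulrC ler_wpM2l ?exprn_ge0//.
  rewrite -ler_pdivrMr ?divr_gt0 ?exprn_gt0// invf_div mulrA//.
rewrite -/f -[leLHS]add0r lerD// ler_pM2r ?invr_gt0// lerXn2r// nnegrE//.
exact: le_trans kg_ge0 x_ge.
Unshelve. all: by end_near.
Qed.

Lemma expr_onem_le_expR (R : realType) (x : R) (N : nat) : x <= 1 ->
  (1 - x) ^+ N <= expR (- (N%:R * x)).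
Proof.
move=> x_le1; rewrite -mulrN expRM_natl lerXn2r ?nnegrE ?subr_ge0 ?expR_ge0//.
exact: expR_ge1Dx.
Qed.

Lemma rounding_log2_bounds (R : realType) (n k : nat) : (0 < n)%N ->
  rounding (2 * log2 (n%:R : R)) k -> (2 ^ k <= 2 * n ^ 2)%N /\ (n ^ 2 <= 2 ^ k.+1)%N.
Proof.
move=> n_gt0; rewrite /rounding /log2; have ln2_gt0 : 0 < ln (2 : R) by rewrite ln_gt0// ltr1n.
have nr_gt0 : 0 < n%:R :> R by rewrite ltr0n.
rewrite ltr_norml => /andP[lo hi].
have lnn : ln (n%:R ^+ 2 : R) = 2 * ln n%:R by rewrite lnXn// mulr_natl.
have ln2X j : ln (2 ^+ j : R) = j%:R * ln 2 by rewrite lnXn// mulr_natl.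
have E : 2 * (ln n%:R / ln 2) * ln 2 = 2 * ln n%:R :> R by field; rewrite gt_eqF.
split; rewrite -(ler_nat R) ?natrM !natrX -ler_ln ?posrE ?mulr_gt0 ?exprn_gt0//.
  rewrite -expr2 lnM ?posrE ?exprn_gt0// lnn ln2X -E -{2}[ln 2]mul1r -mulrDl ler_pM2r//.
  by lra.
by rewrite -expr2 lnn ln2X -E ler_pM2r// -natr1; lra.
Qed.

(** As [n / k >= 2], rounding loses at most half of [n / k]. *)
Lemma equipartition_card (R : realType) (n k : nat) (V : 'I_k -> {set 'I_n}) (i : 'I_k) :
  equipartition R V -> (2 * k <= n)%N -> (n <= 2 * k * #|V i|)%N.
Proof.
move=> [_ _ /(_ i)]; rewrite /rounding ltr_norml => /andP[lo _] le_kn.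
have k_gt0 : 0 < k%:R :> R by rewrite ltr0n (leq_ltn_trans _ (ltn_ord i)).
have : 2 <= n%:R / k%:R :> R by rewrite ler_pdivlMr// -natrM ler_nat.
rewrite -(ler_nat R) !natrM => h.
have -> : n%:R = k%:R * (n%:R / k%:R) :> R by rewrite mulrC divfK// gt_eqF.
rewrite (_ : 2 * _ * _ = k%:R * (2 * #|V i|%:R)); last by ring.
by rewrite ler_pM2l//; lra.
Qed.

Lemma den_ge (R : realType) (u v : nat) (n : nat) (G : {set {set 'I_n}}) (S : {set 'I_n}) :
  (0 < v)%N -> (1 < #|S|)%N -> (u * 'C(#|S|, 2) <= v * #|edges_between G S S|)%N ->
  u%:R / v%:R <= den R G S.
Proof.
move=> v_gt0 S_gt1 le_uv; rewrite /den ler_pdivlMr ?ltr0n ?bin_gt0//.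
by rewrite mulrAC ler_pdivrMr ?ltr0n// -!natrM ler_nat [leqRHS]mulnC.
Qed.

Lemma threshold_failure (R : realType) (a b h : nat) (nodes : seq (nat * nat))
    (n k i N : nat) :
  let D := (last (0, 0)%N nodes).1 in
  path node_lt (0, 0)%N nodes -> all (affordable a b h) ((0, 0)%N :: nodes) ->
  D = (2 * h)%N -> (0 < a)%N -> (i < k)%N -> (0 < threshold D nodes k i)%N ->
  (2 ^ k <= 2 * n ^ 2)%N -> (n <= 2 * k * N)%N ->
  (1 - 'C(i, threshold D nodes k i)%:R / 2 ^+ i) ^+ N <=
  expR (- ((b%:R / a%:R) ^+ (k %/ D) / (2 ^+ D.+2 * k%:R ^+ 3))) :> R.
Proof.
move=> D path_nodes aff D_eq a_gt0 lt_ik w_gt0 k_n n_N.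
have pos2 j : 0 < (2 ^+ j : R) by rewrite exprn_gt0.
apply: le_trans (expr_onem_le_expR _ _) _.
  by rewrite ler_pdivrMr// mul1r -natrX ler_nat leq_bin_exp2.
rewrite ler_expR lerN2.
have := threshold_bin path_nodes aff D_eq lt_ik w_gt0 k_n n_N; rewrite -/D.
move: 'C(_, _) => c; rewrite -(ler_nat R) !(natrM, natrX) => le_c.
have k_gt0 : 0 < k%:R :> R by rewrite ltr0n (leq_ltn_trans _ lt_ik).
rewrite expr_div_n ler_pdivrMr ?(mulr_gt0 (pos2 _) (exprn_gt0 _ k_gt0))//.
rewrite ler_pdivrMr ?exprn_gt0 ?ltr0n//.
rewrite [leRHS](_ : _ =
  2 ^+ D.+2 * k%:R ^+ 3 * a%:R ^+ (k %/ D) * (N%:R * c%:R) / 2 ^+ i).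
  by rewrite ler_pdivlMr.
by move: (2 ^+ D.+2) (2 ^+ i) => t s; ring.
Qed.

(** Both [k] and [n] are at most [expR k], so the product is at most
    [expR (k + k ^ 2 - T) <= expR (- k)]. *)
Lemma greedy_union_bound (R : realType) (n k : nat) (T : R) : (0 < k)%N ->
  (n ^ 2 <= 2 ^ k.+1)%N -> 3 * k%:R ^+ 2 <= T ->
  k%:R * n%:R ^+ k * expR (- T) <= k.+1%:R^-1.
Proof.
move=> k_gt0 n_k T_ge; have k_ge1 : 1 <= k%:R :> R by rewrite ler1n.
have k_le : k%:R <= expR (k%:R : R) by apply: le_trans (expR_ge1Dx _); rewrite lerDr.
have n_le : n%:R <= expR (k%:R : R).
  apply: (@le_trans _ _ (2 ^+ k)).
    rewrite -natrX ler_nat -leq_sqr -expnM (leq_trans n_k)// leq_exp2l//.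
    by rewrite muln2 -addnn -addn1 leq_add2l.
  rewrite -[k%:R]mulr1 expRM_natl lerXn2r// ?nnegrE ?expR_ge0//.
  by apply: le_trans (expR_ge1Dx _).
apply: (@le_trans _ _ (expR (k%:R) * expR (k%:R) ^+ k * expR (- T))).
  rewrite ler_wpM2r ?expR_ge0// ler_pM ?exprn_ge0// lerXn2r ?nnegrE ?expR_ge0//.
rewrite -expRM_natl -!expRD; apply: (@le_trans _ _ (expR (- k%:R))).
  by rewrite ler_expR; nra.
rewrite expRN lef_pV2 ?posrE ?expR_gt0 ?ltr0n// -nat1r.
exact: expR_ge1Dx.
Qed.

(** * Density of the greedy set for large [n] *)

Lemma greedy_density_at (R : realType) (a b h u w : nat) (nodes : seq (nat * nat))
    (n k : nat) (V : 'I_k -> {set 'I_n}) (v : {set {set 'I_n}} -> 'I_k -> 'I_n) (e : R) :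
  let D := (last (0, 0)%N nodes).1 in
  path node_lt (0, 0)%N nodes -> all (affordable a b h) ((0, 0)%N :: nodes) ->
  D = (2 * h)%N -> (0 < h)%N -> (0 < a)%N -> (0 < w)%N ->
  (u * D ^ 2 < w * trapezoids (0, 0)%N nodes)%N -> 0 < e -> (0 < n)%N ->
  (2 ^ k <= 2 * n ^ 2)%N -> (n ^ 2 <= 2 ^ k.+1)%N ->
  (D * (4 * (u * D ^ 2)).+2 <= k)%N -> e^-1 <= k%:R ->
  3 * 2 ^+ D.+2 * k%:R ^+ 5 <= (b%:R / a%:R) ^+ (k %/ D) :> R ->
  8 * k%:R ^+ 2 <= 2 ^+ k :> R ->
  equipartition R V -> (forall G, G \in graphs n -> greedy_run G V (v G)) ->
  1 - e <= gnp_Pr (2^-1 : R) (fun G =>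
    (#|chosen (v G) k| == k) && (u%:R / w%:R <= den R G (chosen (v G) k))).
Proof.
move=> D path_nodes aff D_eq h_gt0 a_gt0 w_gt0 lt_uw e_gt0 n_gt0 k_n n_k K_gt k_e.
move=> polyn sqrn hV' hv'.
have D_gt0 : (0 < D)%N by rewrite D_eq muln_gt0.
have k_gt1 : (1 < k)%N by apply: leq_trans K_gt; nia.
have k_gt0 : (0 < k)%N := ltnW k_gt1.
have kn : (2 * k <= n)%N.
  (* Squared and doubled, the claim follows from [8 * k ^ 2 <= 2 ^ k <= 2 * n ^ 2]. *)
  rewrite -leq_sqr expnMn -(@leq_pmul2l 2)// (leq_trans _ k_n)//.
  by rewrite mulnA -(ler_nat R) natrM !natrX.
set T := (b%:R / a%:R) ^+ (k %/ D) / (2 ^+ D.+2 * k%:R ^+ 3) : R.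
have kr_gt0 : 0 < k%:R :> R by rewrite ltr0n.
(* Of the [k ^ 5] in [polyn], three factors cancel the denominator of [T] and two serve the union
   bound. *)
have T_ge : 3 * k%:R ^+ 2 <= T.
  have two_gt0 : 0 < 2 ^+ D.+2 :> R by rewrite exprn_gt0.
  rewrite ler_pdivlMr ?(mulr_gt0 two_gt0 (exprn_gt0 _ kr_gt0))//.
  by apply: le_trans polyn; rewrite le_eqVlt; apply/orP; left; apply/eqP; ring.
have [dV _ _] := hV'.
have := @greedy_success_Pr R n k V v (threshold D nodes k) (expR (- T)) n_gt0 dV hv'.
have small (i : 'I_k) : (0 < threshold D nodes k i)%N ->
    (1 - 'C(i, threshold D nodes k i)%:R / 2 ^+ i) ^+ #|V i| <= expR (- T).
  move=> w_i; apply: threshold_failure path_nodes aff D_eq a_gt0 (ltn_ord i) w_i k_n _.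
  exact: equipartition_card hV' kn.
move=> /(_ small (expR_ge0 _)) Pr_ge.
have fail_le : k%:R * n%:R ^+ k * expR (- T) <= e.
  apply: le_trans (greedy_union_bound k_gt0 n_k T_ge) _.
  rewrite -[e]invrK lef_pV2 ?posrE ?invr_gt0 ?ltr0n//.
  by rewrite (le_trans k_e)// ler_nat.
apply: le_trans (le_trans _ Pr_ge) _; first by rewrite lerB.
rewrite !gnp_Pr_half ler_pM2r ?invr_gt0 ?exprn_gt0// ler_nat.
apply/subset_leq_card/subsetP => G; rewrite !inE => /and3P[-> /eqP cS le_w] /=.
rewrite cS eqxx /=; apply: den_ge; rewrite // cS//.
apply: leq_trans (leq_mul (leqnn w) le_w).
apply: sum_threshold => //.
by rewrite leq_divRL// mulnC (leq_trans _ K_gt)// leq_mul2l ltnW ?orbT.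
Qed.

Lemma greedy_density (R : realType) (a b h u w : nat) (nodes : seq (nat * nat))
    (k : nat -> nat)
    (V : forall n : nat, 'I_(k n) -> {set 'I_n})
    (v : forall n : nat, {set {set 'I_n}} -> 'I_(k n) -> 'I_n) :
  let D := (last (0, 0)%N nodes).1 in
  path node_lt (0, 0)%N nodes -> all (affordable a b h) ((0, 0)%N :: nodes) ->
  D = (2 * h)%N -> (0 < h)%N -> (0 < a < b)%N ->
  (u * D ^ 2 < w * trapezoids (0, 0)%N nodes)%N ->
  (\forall n \near \oo, rounding (2 * log2 (n%:R : R)) (k n)) ->
  (\forall n \near \oo, equipartition R (V n)) ->
  (\forall n \near \oo, forall G : {set {set 'I_n}},
      G \in graphs n -> greedy_run G (V n) (v n G)) ->
  gnp_Pr (2^-1 : R) (fun G : {set {set 'I_n}} =>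
      let S := chosen (v n G) (k n) in
      (#|S| == k n) && (u%:R / w%:R <= den R G S))
    @[n --> \oo] --> (1 : R).
Proof.
move=> D path_nodes aff D_eq h_gt0 /andP[a_gt0 lt_ab] lt_uw hk hV hv.
have D_gt0 : (0 < D)%N by rewrite D_eq muln_gt0.
have w_gt0 : (0 < w)%N by case: (w) lt_uw => //; rewrite mul0n ltn0.
have k_cvg : k n @[n --> \oo] --> \oo.
  apply/cvgnyPge => M; near=> n.
  have n_gt0 : (0 < n)%N by near: n; exact: nbhs_infty_gt.
  have hkn : rounding (2 * log2 (n%:R : R)) (k n) by near: n.
  have [_ n_k] := rounding_log2_bounds n_gt0 hkn.
  have : (2 ^ M <= n)%N by near: n; exact: nbhs_infty_ge.
  rewrite -leq_sqr => /leq_trans/(_ n_k); rewrite -expnM leq_exp2l// => le_M.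
  by case: (M) le_M => // M'; lia.
have q_gt1 : 1 < b%:R / a%:R :> R by rewrite ltr_pdivlMr ?ltr0n// mul1r ltr_nat.
have k_poly : \forall n \near \oo,
    3 * 2 ^+ D.+2 * (k n)%:R ^+ 5 <= (b%:R / a%:R) ^+ (k n %/ D) :> R.
  exact: k_cvg _ (poly_le_exp_near _ _ q_gt1 D_gt0).
(* The division by 1 matches the form of [poly_le_exp_near]. *)
have k_sqr : \forall n \near \oo, 8 * (k n)%:R ^+ 2 <= 2 ^+ (k n %/ 1) :> R.
  by apply: k_cvg _ (poly_le_exp_near _ _ _ _) => //; rewrite ltr1n.
apply/cvgrPdist_le => e e_gt0; near=> n.
have n_gt0 : (0 < n)%N by near: n; exact: nbhs_infty_gt.
have hkn : rounding (2 * log2 (n%:R : R)) (k n) by near: n.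
have hVn : equipartition R (V n) by near: n.
have hvn : forall G : {set {set 'I_n}}, G \in graphs n -> greedy_run G (V n) (v n G).
  by near: n.
have polyn : 3 * 2 ^+ D.+2 * (k n)%:R ^+ 5 <= (b%:R / a%:R) ^+ (k n %/ D) :> R by near: n.
have sqrn : 8 * (k n)%:R ^+ 2 <= 2 ^+ (k n) :> R by rewrite -{2}[k n]divn1; near: n.
have K_gt : (D * (4 * (u * D ^ 2)).+2 <= k n)%N.
  by near: n; move/cvgnyPge: k_cvg; apply.
have k_e : e^-1 <= (k n)%:R.
  near: n; exact: k_cvg _ (nbhs_infty_ger _).
have {hkn} [k_n n_k] := rounding_log2_bounds n_gt0 hkn.
rewrite ger0_norm ?subr_ge0 ?gnp_Pr_half_le1// lerBlDr -lerBlDl.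
exact: (greedy_density_at path_nodes aff D_eq h_gt0 a_gt0 w_gt0 lt_uw e_gt0
  n_gt0 k_n n_k K_gt k_e polyn sqrn hVn hvn).
Unshelve. all: by end_near.
Qed.

Theorem theorem1 (R : realType)
    (k : nat -> nat)
    (V : forall n : nat, 'I_(k n) -> {set 'I_n})
    (v : forall n : nat, {set {set 'I_n}} -> 'I_(k n) -> 'I_n)
    (hk : \forall n \near \oo, rounding (2 * log2 (n%:R : R)) (k n))
    (hV : \forall n \near \oo, equipartition R (V n))
    (hv : \forall n \near \oo, forall G : {set {set 'I_n}},
        G \in graphs n -> greedy_run G (V n) (v n G)) :
  exists delta : nat -> R,
    delta n @[n --> \oo] --> (0 : R) /\
    gnp_Pr (2^-1 : R) (fun G : {set {set 'I_n}} =>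
        let S := chosen (v n G) (k n) in
        (#|S| == k n) && (951 / 1000 - delta n <= den R G S))
      @[n --> \oo] --> (1 : R).
Proof.
(* No error term is needed: the polygon gives strictly more than [951 / 1000], and this margin
   absorbs the lower-order losses. *)
exists (fun=> 0); split; first exact: cvg_cst.
rewrite subr0.
apply:
  (greedy_density greedy_nodes_path greedy_nodes_affordable _ _ _ trapezoids_greedy_nodes
     hk hV hv) => //.
Qed.
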